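(* Let $A$ be an admissible operator-semantic system. If all local contextual realizations of $A$ glue to global realizations and the resulting spectral stack $\mathfrak{Spec}(A)$ has only trivial inertia sectors, then $$\operatorname{CtxDeg}_{\mathrm{red}}(A)=0.$$ In particular, if $A$ is commutative and its categorified spectrum reduces to an ordinary $0$-stack, then $\operatorname{CtxDeg}_{\mathrm{red}}(A)=0$.
   Context: An admissible operator-semantic system presenting an operator system or C*-algebra $A$ is a tuple $(\mathcal O_A,\mathcal C_A,\tau_A,\rho_A)$ where: (1) $\mathcal O_A$ (the synergy operad) is a small non-symmetric colored operad in sets. Its colors are a chosen collection of operator types of $A$; operations are formal operator expressions built from the primitive operations of $A$, identified if they denote the same operator in $A$; composition is substitution. (2) $\mathcal C_A$ has as objects designated commutative substructures of $A$ (contexts) and as morphisms inclusions (more generally admissible context transitions); it is essentially small. (3) $\tau_A$ is the Grothendieck topology on $\mathcal C_A$ whose covers are the families $\{C_i\to C\}$ such that every operator in $C$ is obtained from operators of the $C_i$ by operations of $\mathcal O_A$. (4) $\rho_A:\mathcal O_A\to\operatorname{End}_{\operatorname{PSh}_{\mathbf{Ban}}(\mathcal C_A)}$ is a morphism of colored operads to the endomorphism operad of Banach-space-valued presheaves on $\mathcal C_A$. Let $\pi_A$ be the functor from the category of colors to $\mathcal C_A$ sending a color to the minimal commutative context in which an operator of that type can be evaluated, and $\operatorname{Syn}_A(c)$ the presheaf of admissible local realizations of a color $c$, modelled by $\operatorname{Hom}_{\mathcal C_A}(-,\pi_A(c))$. $\mathfrak{Spec}_{\mathrm{pre}}(A)=\operatorname{Lan}_{\pi_A}(\operatorname{Syn}_A)$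 is the space-valued presheaf $C\mapsto\operatorname{colim}_{(c,\phi:\pi_A(c)\to C)}\operatorname{Syn}_A(c)(\pi_A(c))$, and $\mathfrak{Spec}(A)$ is its hypersheafification with respect to $\tau_A$. The inertia stack is $I(\mathfrak{Spec}(A))=\operatorname{Map}(S^1,\mathfrak{Spec}(A))$, whose points are pairs $(x,\alpha)$ with $x\in\mathfrak{Spec}(A)$ and $\alpha\in\operatorname{Aut}(x)$. $I_{\mathrm{triv}}(\mathfrak{Spec}(A))$ is the union of inertia components arising from identity automorphisms of globally compatible classical realizations. The reduced contextuality degree is $$\operatorname{CtxDeg}_{\mathrm{red}}(A)=\bigl|\pi_0\bigl(I(\mathfrak{Spec}(A))\setminus I_{\mathrm{triv}}(\mathfrak{Spec}(A))\bigr)\bigr|.$$ Inertia sectors are connected components of the inertia stack; only trivial inertia sectors means there are no automorphism sectors beyond identity automorphisms.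
   Formalization: The displayed colimit for Spec_pre(A) is covariant in C and so defines no presheaf; it is replaced by the homotopy colimit over colors c of Syn_A(c) = Hom(-, pi_A(c)), i.e. over pairs (c, phi : C -> pi_A(c)), with the direction of phi reversed. *)

(* Defs.v *)
From Stdlib Require Import Relations.
From mathcomp Require Import all_boot all_order all_algebra.
From mathcomp Require Import complex.
From mathcomp Require Import all_classical all_reals all_analysis.

Set Implicit Arguments.
Unset Strict Implicit.
Unset Printing Implicit Defensive.

Import Order.TTheory GRing.Theory Num.Theory.
Import numFieldNormedType.Exports.

Local Open Scope classical_set_scope.
Local Open Scope ring_scope.

Lemma sig_ext (T : Type) (P : T -> Prop) (x y : {z | P z}) :
  sval x = sval y -> x = y.
Proof.
case: x y => [x px] [y py] /= e; move: py; rewrite -e => py.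
by rewrite (Prop_irrelevance px py).
Qed.

Record category := Category {
  ob :> Type;
  hom : ob -> ob -> Type;
  idh : forall a, hom a a;
  comph : forall a b c, hom b c -> hom a b -> hom a c;
  comph1 : forall a b (f : hom a b), comph f (idh a) = f;
  comp1h : forall a b (f : hom a b), comph (idh b) f = f;
  comphA : forall a b c d (h : hom c d) (g : hom b c) (f : hom a b),
    comph h (comph g f) = comph (comph h g) f
}.
Arguments hom {_}.
Arguments idh {_}.

Notation "g \oc f" := (comph g f) (at level 40, left associativity).

Record functor (C D : category) := Functor {
  fob :> C -> D;
  fmor : forall a b, hom a b -> hom (fob a) (fob b);
  fmor1 : forall a, fmor (idh a) = idh (fob a);
  fmorM : forall a b c (g : hom b c) (f : hom a b),
    fmor (g \oc f) = fmor g \oc fmor f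
}.

Definition point_cat : category.
Proof.
refine (@Category unit (fun _ _ => unit) (fun _ => tt)
          (fun _ _ _ _ _ => tt) _ _ _) => //; by move=> ? ? [].
Defined.

Record sieve (C : category) (a : C) := Sieve {
  insieve :> forall b, hom b a -> Prop;
  insieve_comp : forall b c (f : hom b a) (g : hom c b),
    insieve f -> insieve (f \oc g)
}.

Definition max_sieve (C : category) (a : C) : sieve a :=
  @Sieve C a (fun _ _ => True) (fun _ _ _ _ _ => I).

Definition pullback_sieve (C : category) (a b : C) (f : hom b a)
  (S : sieve a) : sieve b.
Proof.
refine (@Sieve C b (fun c g => S c (f \oc g)) _).
by move=> c d g h Sg; rewrite comphA; exact: insieve_comp.
Defined.

Definition family_sieve (C : category) (a : C) (I : Type) (d : I -> C)
  (f : forall i, hom (d i) a) : sieve a.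
Proof.
refine (@Sieve C a
  (fun b g => exists (i : I) (h : hom b (d i)), g = f i \oc h) _).
by move=> b c g h [i [k ->]]; exists i, (k \oc h); rewrite comphA.
Defined.

Record is_topology (C : category) (tau : forall a : C, sieve a -> Prop) : Prop :=
  IsTopology {
  top_max : forall a, tau a (max_sieve a);
  top_stable : forall a b (f : hom b a) (S : sieve a),
    tau a S -> tau b (pullback_sieve f S);
  top_trans : forall a (S S' : sieve a), tau a S ->
    (forall b (f : hom b a), S b f -> tau b (pullback_sieve f S')) -> tau a S'
}.

(* The simplex category: objects are the n : nat, standing for {0,...,n}. *)
Definition is_mono m n (f : 'I_m.+1 -> 'I_n.+1) : Prop :=
  {homo f : i j / (i <= j)%N}.

Definition mono (m n : nat) : Type := {f | @is_mono m n f}.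

Definition mono_id n : mono n n := exist (@is_mono n n) id (fun _ _ h => h).

Definition mono_comp l m n (g : mono m n) (f : mono l m) : mono l n :=
  exist (@is_mono l n) (sval g \o sval f)
    (fun i j h => proj2_sig g _ _ (proj2_sig f i j h)).

Definition mono_cst m n (k : 'I_n.+1) : mono m n :=
  exist (@is_mono m n) (fun _ => k) (fun _ _ _ => leqnn k).

Record sPsh (C : category) := SPsh {
  spx :> C -> nat -> Type;
  sact : forall b a (f : hom b a) m n (t : mono m n), spx a n -> spx b m;
  sact1 : forall a n (x : spx a n), sact (idh a) (mono_id n) x = x;
  sactM : forall c b a (f : hom b a) (g : hom c b) l m n
    (t : mono m n) (s : mono l m) (x : spx a n),
    sact (f \oc g) (mono_comp t s) x = sact g s (sact f t x)
}.
Arguments sact {_} _ {b a} f {m n} t _ : rename.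

(* Simplicial sets are simplicial presheaves on the point. *)
Notation sSet := (sPsh point_cat).

Definition sop (C : category) (X : sPsh C) (a : C) m n (t : mono m n)
  (x : X a n) : X a m := sact X (idh a) t x.

Definition sres (C : category) (X : sPsh C) (a b : C) (f : hom b a) n
  (x : X a n) : X b n := sact X f (mono_id n) x.

Definition is_natural (C : category) (P Q : sPsh C)
  (h : forall a n, P a n -> Q a n) : Prop :=
  forall b a (f : hom b a) m n (t : mono m n) (x : P a n),
    h b m (sact P f t x) = sact Q f t (h a n x).

Definition smap (C : category) (P Q : sPsh C) : Type :=
  {h | @is_natural C P Q h}.

Definition mksmap (C : category) (P Q : sPsh C) (h : forall a n, P a n -> Q a n)
  (hP : is_natural h) : smap P Q := exist (@is_natural C P Q) h hP.
Arguments mksmap {C P Q} & h hP.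

Definition sapp (C : category) (P Q : sPsh C) (h : smap P Q) (a : C) n :
  P a n -> Q a n := sval h a n.
Coercion sapp : smap >-> Funclass.

Lemma smap_ext (C : category) (P Q : sPsh C) (h k : smap P Q) :
  (forall a n (x : P a n), h a n x = k a n x) -> h = k.
Proof.
move=> e; apply: sig_ext.
apply: functional_extensionality_dep => a.
apply: functional_extensionality_dep => n.
by apply: functional_extensionality_dep => x; exact: e.
Qed.

Definition sid (C : category) (P : sPsh C) : smap P P :=
  mksmap (fun _ _ x => x) (fun _ _ _ _ _ _ _ => erefl).

Definition scomp (C : category) (P Q S : sPsh C) (h : smap Q S) (k : smap P Q) :
  smap P S.
Proof.
refine (mksmap (fun a n x => h a n (k a n x)) _).
by move=> b a f m n t x; rewrite /sapp (proj2_sig k) (proj2_sig h).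
Defined.

Definition sprod (C : category) (P Q : sPsh C) : sPsh C.
Proof.
refine (@SPsh C (fun a n => (P a n * Q a n)%type)
  (fun b a f m n t x => (sact P f t x.1, sact Q f t x.2)) _ _).
- by move=> a n [x y]; rewrite !sact1.
- by move=> *; rewrite !sactM.
Defined.

Definition sprod_map (C : category) (P P' Q Q' : sPsh C) (h : smap P P')
  (k : smap Q Q') : smap (sprod P Q) (sprod P' Q').
Proof.
refine (mksmap (fun a n x => (h a n x.1, k a n x.2)) _).
by move=> b a f m n t x; rewrite /sapp (proj2_sig k) (proj2_sig h).
Defined.

Definition scst (C : category) (K : sSet) : sPsh C.
Proof.
refine (@SPsh C (fun _ n => K tt n) (fun b a _ m n t => @sop _ K tt m n t) _ _).
- by move=> a n x; rewrite /sop sact1.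
- by move=> *; rewrite /sop -sactM.
Defined.

Definition scst_map (C : category) (K L : sSet) (h : smap K L) :
  smap (scst C K) (scst C L) :=
  mksmap (fun _ n => h tt n)
    (fun _ _ _ m n t x => proj2_sig h tt tt tt m n t x).

Definition seval (C : category) (X : sPsh C) (a : C) : sSet.
Proof.
refine (@SPsh point_cat (fun _ n => X a n) (fun _ _ _ m n t => @sop _ X a m n t)
          _ _).
- by move=> _ n x; rewrite /sop sact1.
- move=> c' b' a' f' g' l m n t s x.
  by rewrite /sop -sactM comph1.
Defined.

Definition seval_res (C : category) (X : sPsh C) (a b : C) (f : hom b a) :
  smap (seval X a) (seval X b).
Proof.
refine (mksmap (fun _ n => @sres _ X a b f n) _).
move=> b' a' f' m n t x; rewrite /= /sres /sop -!sactM comph1 comp1h.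
by congr (sact X f _ x); exact: sig_ext.
Defined.

Definition seval_map (C : category) (X Y : sPsh C) (h : smap X Y) (a : C) :
  smap (seval X a) (seval Y a) :=
  mksmap (fun _ n => h a n)
    (fun _ _ _ m n t x => proj2_sig h a a (idh a) m n t x).

Definition ssub (C : category) (X : sPsh C) (V : forall a n, X a n -> Prop)
  (VP : forall b a (f : hom b a) m n (t : mono m n) (x : X a n),
    V a n x -> V b m (sact X f t x)) : sPsh C.
Proof.
refine (@SPsh C (fun a n => {x : X a n | V a n x})
  (fun b a f m n t x =>
     exist _ (sact X f t (sval x)) (VP b a f m n t _ (proj2_sig x))) _ _).
- by move=> a n [x px]; apply: sig_ext; rewrite /= sact1.
- by move=> c b a f g l m n t s [x px]; apply: sig_ext; rewrite /= sactM.
Defined.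

Definition simplex (n : nat) : sSet.
Proof.
refine (@SPsh point_cat (fun _ m => mono m n)
  (fun _ _ _ l m t s => mono_comp s t) _ _).
- by move=> _ m x; exact: sig_ext.
- by move=> *; exact: sig_ext.
Defined.

Definition simplex_map m n (t : mono m n) : smap (simplex m) (simplex n).
Proof.
refine (mksmap (fun _ l s => mono_comp t s) _).
by move=> *; exact: sig_ext.
Defined.

Definition boundary (n : nat) : sSet.
Proof.
refine (@ssub _ (simplex n)
  (fun _ m s => exists i, forall j, sval (s : mono m n) j <> i) _).
by move=> b' a' f' l m t s [i si]; exists i => j; exact: si.
Defined.

Definition horn (n : nat) (k : 'I_n.+1) : sSet.
Proof.
refine (@ssub _ (simplex n)
  (fun _ m s => exists2 i, i <> k & forall j, sval (s : mono m n) j <> i) _).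
by move=> b' a' f' l m t s [i ik si]; exists i => // j; exact: si.
Defined.

Definition i10 : 'I_2 := ord0.
Definition i11 : 'I_2 := ord_max.

Definition circle_norm m (s : mono m 1) : mono m 1 :=
  if sval s ord0 == i11 then mono_cst m i10 else s.

Lemma I2_cases (i : 'I_2) : i = i10 \/ i = i11.
Proof. by case: i => -[|[|//]] h; [left | right]; apply/val_inj. Qed.

Lemma circle_norm0 m (s : mono m 1) : sval (circle_norm s) ord0 = i10.
Proof.
by rewrite /circle_norm; case: eqP => //=; case: (I2_cases (sval s ord0)).
Qed.

Lemma circle_norm_comp l m (s : mono m 1) (t : mono l m) :
  circle_norm (mono_comp (circle_norm s) t) = circle_norm (mono_comp s t).
Proof.
rewrite {2}/circle_norm; case: eqP => // e.
have e' : sval (mono_comp s t) ord0 = i11.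
  have := proj2_sig s ord0 (sval t ord0) (leq0n _).
  by rewrite e /=; have [->|->] := I2_cases (sval s (sval t ord0)).
by rewrite /circle_norm e' eqxx /=; exact: sig_ext.
Qed.

(* The circle Delta^1 / boundary: an m-simplex of Delta^1 which is constant at
   1 is identified with the one constant at 0. *)
Definition circle : sSet.
Proof.
refine (@SPsh point_cat (fun _ m => {s : mono m 1 | sval s ord0 = i10})
  (fun _ _ _ l m t s =>
    exist _ (circle_norm (mono_comp (sval s) t)) (circle_norm0 _)) _ _).
- move=> _ m [s s0]; apply: sig_ext => /=.
  have -> : mono_comp s (mono_id m) = s by exact: sig_ext.
  by rewrite /circle_norm s0; case: eqP.
- move=> c' b' a' f' g' l m n t s [x x0]; apply: sig_ext => /=.
  by rewrite circle_norm_comp; congr circle_norm; exact: sig_ext.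
Defined.

Definition edge (K : sSet) (x y : K tt 0) : Prop :=
  exists e : K tt 1%N, sop (mono_cst 0 i10) e = x /\ sop (mono_cst 0 i11) e = y.

Definition connected_to (K : sSet) : relation (K tt 0) :=
  clos_refl_sym_trans (K tt 0) (@edge K).

Definition component (K : sSet) (x : K tt 0) : set (K tt 0) :=
  [set y | connected_to x y].

Definition pi0 (K : sSet) : set (set (K tt 0)) := range (@component K).
Arguments pi0 K : clear implicits.

Definition elem_homotopy (C : category) (P Q : sPsh C) (f g : smap P Q) : Prop :=
  exists H : smap (sprod P (scst C (simplex 1))) Q,
    (forall a n x, H a n (x, mono_cst n i10) = f a n x) /\
    (forall a n x, H a n (x, mono_cst n i11) = g a n x).

Definition homotopic (C : category) (P Q : sPsh C) : relation (smap P Q) :=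
  clos_refl_sym_trans (smap P Q) (@elem_homotopy C P Q).

Definition homotopy_equivalence (C : category) (P Q : sPsh C) (f : smap P Q) :
  Prop :=
  exists g : smap Q P, homotopic (scomp g f) (sid P) /\
                       homotopic (scomp f g) (sid Q).

Definition sMap (C : category) (P Q : sPsh C) : sSet.
Proof.
refine (@SPsh point_cat (fun _ n => smap (sprod P (scst C (simplex n))) Q)
  (fun _ _ _ m n t h =>
     scomp h (sprod_map (sid P) (scst_map C (simplex_map t)))) _ _).
- move=> _ n h; apply: smap_ext => a m [x s] /=.
  by congr (h a m (_, _)); exact: sig_ext.
- move=> c' b' a' f' g' l m n t s h; apply: smap_ext => a k [x u] /=.
  by congr (h a k (_, _)); exact: sig_ext.
Defined.

Definition sMap_post (C : category) (P Q Q' : sPsh C) (h : smap Q Q') :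
  smap (sMap P Q) (sMap P Q').
Proof.
refine (mksmap (fun _ n k => scomp h (k : smap _ _)) _).
by move=> *; exact: smap_ext.
Defined.

Definition sMap_pre (C : category) (P P' Q : sPsh C) (h : smap P P') :
  smap (sMap P' Q) (sMap P Q).
Proof.
refine (mksmap (fun _ n k =>
  scomp (k : smap _ _) (sprod_map h (sid (scst C (simplex n))))) _).
by move=> *; exact: smap_ext.
Defined.

Definition is_kan (K : sSet) : Prop :=
  forall (n : nat) (k : 'I_n.+1), (0 < n)%N ->
  forall h : smap (horn k) K, exists x : K tt n,
    forall m (s : horn k tt m), sop (sval s : mono m n) x = h tt m s.

(* Weak homotopy equivalence of arbitrary simplicial sets: bijectivity on
   homotopy classes of maps into every Kan complex. *)
Definition weak_equivalence (K L : sSet) (f : smap K L) : Prop :=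
  forall Z : sSet, is_kan Z ->
    (forall u : smap K Z, exists v : smap L Z, homotopic (scomp v f) u) /\
    (forall v w : smap L Z, homotopic (scomp v f) (scomp w f) -> homotopic v w).

Definition representable (C : category) (a : C) : sPsh C.
Proof.
refine (@SPsh C (fun b _ => hom b a) (fun c b f _ _ _ g => g \oc f) _ _).
- by move=> b n f; rewrite comph1.
- by move=> *; rewrite comphA.
Defined.

Definition injectively_fibrant (C : category) (X : sPsh C) : Prop :=
  forall (K L : sPsh C) (i : smap K L),
    (forall a n, injective (i a n)) ->
    (forall a, weak_equivalence (seval_map i a)) ->
    forall k : smap K X, exists l : smap L X, scomp l i = k.

(* A hypercover of a is a local trivial fibration U -> Hom(-, a): every square
   from boundary(n) -> simplex(n) over an object b has a lift after restriction
   along a covering sieve of b.  (For n > 0 a map simplex(n) -> Hom(b, a) is an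
   element f of Hom(b, a), the target being discrete.) *)
Definition is_hypercover (C : category) (tau : forall a : C, sieve a -> Prop)
  (a : C) (U : sPsh C) (p : smap U (representable a)) : Prop :=
  forall (n : nat) (b : C) (f : hom b a) (d : smap (boundary n) (seval U b)),
    (forall m (s : boundary n tt m), p b m (d tt m s) = f) ->
    exists2 S : sieve b, tau b S &
      forall c (g : hom c b), S c g -> exists u : U c n,
        p c n u = f \oc g /\
        forall m (s : boundary n tt m),
          sop (sval s : mono m n) u = sres g (d tt m s : U b m).

(* Map(-, X) is the derived mapping space because X is injectively fibrant. *)
Definition is_hypersheaf (C : category) (tau : forall a : C, sieve a -> Prop)
  (X : sPsh C) : Prop :=
  injectively_fibrant X /\
  forall (a : C) (U : sPsh C) (p : smap U (representable a)),
    is_hypercover tau p -> homotopy_equivalence (sMap_pre X p).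

Definition is_hypersheafification (C : category)
  (tau : forall a : C, sieve a -> Prop) (P X : sPsh C) (eta : smap P X) : Prop :=
  is_hypersheaf tau X /\
  forall Y : sPsh C, is_hypersheaf tau Y -> homotopy_equivalence (sMap_pre Y eta).

(* The space of global points of a stack: the limit of its values.  It is
   Map(1, X), hence the homotopy limit when X is injectively fibrant. *)
Definition is_global (C : category) (X : sPsh C) n (x : forall a, X a n) : Prop :=
  forall b a (f : hom b a), sres f (x a) = x b.

Lemma sop_sres (C : category) (X : sPsh C) (b a : C) (f : hom b a) m n
  (t : mono m n) (x : X a n) : sres f (sop t x) = sop t (sres f x).
Proof.
rewrite /sres /sop -!sactM comph1 comp1h.
by congr (sact X f _ x); exact: sig_ext.
Qed.

Lemma is_global_sop (C : category) (X : sPsh C) m n (t : mono m n)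
  (x : forall a, X a n) : is_global x -> is_global (fun a => sop t (x a)).
Proof. by move=> xP b a f; rewrite sop_sres xP. Qed.

Definition points (C : category) (X : sPsh C) : sSet.
Proof.
refine (@SPsh point_cat (fun _ n => {x | @is_global C X n x})
  (fun _ _ _ m n t x =>
     exist (@is_global C X m) _ (is_global_sop t (proj2_sig x))) _ _).
- move=> a n x; apply: sig_ext => /=.
  by apply: functional_extensionality_dep => c; rewrite /sop sact1.
- move=> c' b' a' f' g' l m n t s x; apply: sig_ext => /=.
  by apply: functional_extensionality_dep => c; rewrite /sop -sactM comph1.
Defined.

Definition points_map (C : category) (X Y : sPsh C) (h : smap X Y) :
  smap (points X) (points Y).
Proof.
refine (mksmap (fun _ n x => exist (@is_global C Y n) (fun a => h a n (sval x a)) _) _).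
  move=> b' a' f' m n t x; apply: sig_ext => /=.
  by apply: functional_extensionality_dep => c; rewrite /sapp (proj2_sig h).
Unshelve.
by move=> b a f; rewrite /sres /sapp -(proj2_sig h) -(proj2_sig x b a f).
Defined.

(* I(X) = Map(S^1, X), computed objectwise. *)
Definition inertia (C : category) (X : sPsh C) : sPsh C.
Proof.
refine (@SPsh C (fun a n => sMap circle (seval X a) tt n)
  (fun b a f m n t h => sMap_post circle (seval_res X f) tt m
       (sop t (h : sMap circle (seval X a) tt n))) _ _).
- move=> a n h; rewrite /sop sact1; apply: smap_ext => u m x.
  by rewrite /= /sapp /= /sres sact1.
- move=> c b a f g l m n t s h; apply: smap_ext => u k [x y].
  rewrite /= /sapp /= /sres -sactM.
  have -> : mono_id k = mono_comp (mono_id k) (mono_id k) by exact: sig_ext.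
  congr (sact X _ _ (sval h u k (_, _))) => //; exact: sig_ext.
Defined.

Definition const_loop (C : category) (X : sPsh C) (a : C) n (x : X a n) :
  sMap circle (seval X a) tt n.
Proof.
refine (mksmap (fun u m y => sop (y.2 : mono m n) x) _).
by move=> b' a' f' k m t y; rewrite /= /sop -sactM comph1.
Defined.

(* x |-> (x, id_x); the points of I(X) are pairs of a point and a loop at it. *)
Definition identity_loop (C : category) (X : sPsh C) : smap X (inertia X).
Proof.
refine (mksmap (fun a n x => const_loop x : inertia X a n) _).
move=> b a f m n t x; apply: smap_ext => u k y.
rewrite /= /sapp /= /sres /sop -!sactM !comph1 comp1h.
by congr (sact X f _ x); exact: sig_ext.
Defined.

Local Open Scope complex_scope.

Record cstar_algebra (R : realType) := CStarAlgebra {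
  cs_car :> completeNormedModType R[i];
  cs_mul : cs_car -> cs_car -> cs_car;
  cs_star : cs_car -> cs_car;
  cs_mulA : associative cs_mul;
  cs_mulDl : left_distributive cs_mul +%R;
  cs_mulDr : right_distributive cs_mul +%R;
  cs_mulZl : forall (k : R[i]) x y, cs_mul (k *: x) y = k *: cs_mul x y;
  cs_mulZr : forall (k : R[i]) x y, cs_mul x (k *: y) = k *: cs_mul x y;
  cs_starK : involutive cs_star;
  cs_starD : {morph cs_star : x y / x + y};
  cs_starZ : forall (k : R[i]) x, cs_star (k *: x) = k^* *: cs_star x;
  cs_starM : forall x y, cs_star (cs_mul x y) = cs_mul (cs_star y) (cs_star x);
  cs_normM : forall x y, `|cs_mul x y| <= `|x| * `|y|;
  cs_normC : forall x, `|cs_mul (cs_star x) x| = `|x| ^+ 2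
}.

Variant structure_kind := OperatorSystem | CStarSubalgebra.

Definition is_selfadjoint_subspace (R : realType) (B : cstar_algebra R)
  (S : set B) : Prop :=
  S 0 /\ (forall (k : R[i]) x y, S x -> S y -> S (k *: x + y)) /\
  (forall x, S x -> S (cs_star x)).

Definition is_unit (R : realType) (B : cstar_algebra R) (e : B) : Prop :=
  forall x, cs_mul e x = x /\ cs_mul x e = x.

Definition is_substructure (R : realType) (B : cstar_algebra R)
  (k : structure_kind) (S : set B) : Prop :=
  is_selfadjoint_subspace S /\
  match k with
  | OperatorSystem => exists2 e, is_unit e & S e
  | CStarSubalgebra => (forall x y, S x -> S y -> S (cs_mul x y)) /\ closed S
  end.

Definition commuting (R : realType) (B : cstar_algebra R) (S : set B) : Prop :=
  forall x y, S x -> S y -> cs_mul x y = cs_mul y x.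

(* An operator system or a C*-algebra is given inside an ambient C*-algebra; for
   a C*-algebra the ambient one may be itself. *)
Record operator_structure (R : realType) := OperatorStructure {
  ambient :> cstar_algebra R;
  kind : structure_kind;
  operators : set ambient;
  operatorsP : is_substructure kind operators
}.

Fixpoint hprod (I : Type) (T : I -> Type) (cs : seq I) : Type :=
  if cs is c :: cs' then (T c * hprod T cs')%type else unit.

Fixpoint hsplit (I : Type) (T : I -> Type) (cs cs' : seq I) :
  hprod T (cs ++ cs') -> hprod T cs * hprod T cs' :=
  match cs return hprod T (cs ++ cs') -> hprod T cs * hprod T cs' with
  | [::] => fun v => (tt, v)
  | c :: cs1 => fun v => let w := hsplit v.2 in ((v.1, w.1), w.2)
  end.

Fixpoint hall (I : Type) (T : I -> Type) (Q : forall c, T c -> Prop)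
  (cs : seq I) : hprod T cs -> Prop :=
  match cs return hprod T cs -> Prop with
  | [::] => fun _ => True
  | c :: cs' => fun v => Q c v.1 /\ hall Q v.2
  end.

Fixpoint hmap (I : Type) (T T' : I -> Type) (h : forall c, T c -> T' c)
  (cs : seq I) : hprod T cs -> hprod T' cs :=
  match cs return hprod T cs -> hprod T' cs with
  | [::] => fun _ => tt
  | c :: cs' => fun v => (h c v.1, hmap h v.2)
  end.

(* A list of operations, one for each color of the second index, whose
   concatenated inputs are the first index. *)
Inductive forest (I : Type) (op : seq I -> I -> Type) :
  seq I -> seq I -> Type :=
| fnil : forest op [::] [::]
| fcons cs d cs' ds :
    op cs d -> forest op cs' ds -> forest op (cs ++ cs') (d :: ds).

Fixpoint forest_eval (I : Type) (op : seq I -> I -> Type) (T : I -> Type)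
  (ev : forall cs c, op cs c -> hprod T cs -> T c) (cs ds : seq I)
  (F : forest op cs ds) : hprod T cs -> hprod T ds :=
  match F in forest _ cs ds return hprod T cs -> hprod T ds with
  | fnil => fun _ => tt
  | fcons cs1 d cs2 ds2 f F' => fun v =>
      let w := hsplit v in (ev cs1 d f w.1, forest_eval ev F' w.2)
  end.

Record operator_signature (R : realType) (A : operator_structure R) :=
  OperatorSignature {
  color : Type;
  optype : color -> set A;
  optype_sub : forall c, optype c `<=` @operators R A;
  prim : Type;
  prim_dom : prim -> seq color;
  prim_cod : prim -> color;
  prim_fun : forall p, hprod (fun c => {x | optype c x}) (prim_dom p) ->
                       {x | optype (prim_cod p) x}
}.

Definition typed (R : realType) (A : operator_structure R)
  (Sg : operator_signature A) (c : color Sg) : Type := {x | optype c x}.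

Inductive expr (R : realType) (A : operator_structure R)
  (Sg : operator_signature A) : seq (color Sg) -> color Sg -> Type :=
| EVar c : expr [:: c] c
| EPrim p : expr (prim_dom p) (prim_cod p)
| ESubst cs ds e : expr ds e -> forest (@expr R A Sg) cs ds -> expr cs e.

Fixpoint denote (R : realType) (A : operator_structure R)
  (Sg : operator_signature A) (cs : seq (color Sg)) (c : color Sg)
  (t : expr cs c) : hprod (@typed R A Sg) cs -> typed c :=
  match t in expr cs c return hprod (@typed R A Sg) cs -> typed c with
  | EVar c => fun v => v.1
  | EPrim p => @prim_fun R A Sg p
  | ESubst cs ds e g F => fun v => denote g (forest_eval (@denote R A Sg) F v)
  end.

(* Expressions are identified when they denote the same operation, so that an
   operation of the operad is a denotation; colors may be repeated and inputs are
   used in order, once each. *)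
Definition is_denoted (R : realType) (A : operator_structure R)
  (Sg : operator_signature A) (cs : seq (color Sg)) (c : color Sg)
  (f : hprod (@typed R A Sg) cs -> typed c) : Prop :=
  exists t : expr cs c, denote t = f.

Definition synop (R : realType) (A : operator_structure R)
  (Sg : operator_signature A) (cs : seq (color Sg)) (c : color Sg) : Type :=
  {f | @is_denoted R A Sg cs c f}.

Definition synid (R : realType) (A : operator_structure R)
  (Sg : operator_signature A) (c : color Sg) : synop [:: c] c :=
  exist (@is_denoted R A Sg [:: c] c) _ (ex_intro _ (EVar c) erefl).

Lemma forest_denoted (R : realType) (A : operator_structure R)
  (Sg : operator_signature A) (cs ds : seq (color Sg))
  (F : forest (@synop R A Sg) cs ds) :
  exists F' : forest (@expr R A Sg) cs ds,
    forest_eval (@denote R A Sg) F' =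
    forest_eval (fun cs c (o : synop cs c) => sval o) F.
Proof.
elim: F => [|cs1 d cs2 ds2 [f [t tf]] F [F' FF']]; first by exists (fnil _).
by exists (fcons t F') => /=; rewrite tf FF'.
Qed.

Definition syncomp (R : realType) (A : operator_structure R)
  (Sg : operator_signature A) (cs ds : seq (color Sg)) (e : color Sg)
  (g : synop ds e) (F : forest (@synop R A Sg) cs ds) : synop cs e.
Proof.
exists (fun v => sval g (forest_eval (fun cs c (o : synop cs c) => sval o) F v)).
case: g => g [t tg]; have [F' FF'] := forest_denoted F.
by exists (ESubst t F'); rewrite /= tg FF'.
Defined.

(* Morphisms of colors are the unary operations of the operad. *)
Definition color_cat (R : realType) (A : operator_structure R)
  (Sg : operator_signature A) : category.
Proof.
refine (@Category (color Sg) (fun c d => @synop R A Sg [:: c] d)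
  (@synid R A Sg) (fun a b c g f => syncomp g (fcons f (fnil _))) _ _ _).
- move=> a b f; apply: sig_ext => /=.
  by apply: functional_extensionality_dep => -[x []].
- move=> a b f; apply: sig_ext => /=.
  by apply: functional_extensionality_dep => -[x []].
- move=> a b c d h g f; apply: sig_ext => /=.
  by apply: functional_extensionality_dep => -[x []].
Defined.

(* Objects are indices of designated commutative substructures, several of which
   may carry the same set.  Morphisms are transitions acting on operators and
   include all inclusions; the case of inclusions only is a thin category with
   identity transitions. *)
Record context_category (R : realType) (A : operator_structure R) :=
  ContextCategory {
  ctx_cat :> category;
  ctx : ctx_cat -> set A;
  ctx_sub : forall C, ctx C `<=` @operators R A;
  ctx_substructure : forall C, is_substructure (kind A) (ctx C);
  ctx_commuting : forall C, commuting (ctx C);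
  transition : forall C D : ctx_cat, hom C D -> A -> A;
  transition_ctx : forall C D (f : hom C D) x, ctx C x -> ctx D (transition f x);
  transition_id : forall C x, ctx C x -> transition (idh C) x = x;
  transition_comp : forall C D E (g : hom D E) (f : hom C D) x, ctx C x ->
    transition (g \oc f) x = transition g (transition f x);
  transition_linear : forall C D (f : hom C D) (k : R[i]) x y,
    ctx C x -> ctx C y ->
    transition f (k *: x + y) = k *: transition f x + transition f y;
  transition_star : forall C D (f : hom C D) x, ctx C x ->
    transition f (cs_star x) = cs_star (transition f x);
  ctx_inclusion : forall C D : ctx_cat, ctx C `<=` ctx D ->
    exists f : hom C D, forall x, ctx C x -> transition f x = x
}.

(* Every operator of C is obtained from operators of the C_i (transported to C)
   by an operation of the operad. *)
Definition generating (R : realType) (A : operator_structure R)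
  (Sg : operator_signature A) (K : context_category A) (C : K)
  (I : Type) (D : I -> K) (f : forall i, hom (D i) C) : Prop :=
  forall a, ctx C a ->
    exists (cs : seq (color Sg)) (c : color Sg) (o : synop cs c)
           (v : hprod (@typed R A Sg) cs),
      hall (fun c (x : typed c) =>
              exists i, exists2 b, ctx (D i) b & transition (f i) b = sval x) v
      /\ sval (sval o v) = a.

Record banach_presheaf (k : numFieldType) (C : category) := BanachPresheaf {
  bp_car :> C -> completeNormedModType k;
  bp_res : forall b a (f : hom b a), bp_car a -> bp_car b;
  bp_res_linear : forall b a (f : hom b a) (l : k) x y,
    bp_res f (l *: x + y) = l *: bp_res f x + bp_res f y;
  bp_res_bounded : forall b a (f : hom b a),
    exists M : k, forall x, `|bp_res f x| <= M * `|x|;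
  bp_res1 : forall a x, bp_res (idh a) x = x;
  bp_resM : forall c b a (f : hom b a) (g : hom c b) x,
    bp_res (f \oc g) x = bp_res g (bp_res f x)
}.

Fixpoint multilinear (k : numFieldType) (I : Type) (V : I -> lmodType k)
  (W : lmodType k) (cs : seq I) : (hprod (fun c => V c : Type) cs -> W) -> Prop :=
  match cs return (hprod (fun c => V c : Type) cs -> W) -> Prop with
  | [::] => fun _ => True
  | c :: cs' => fun h =>
      (forall w (l : k) x y, h (l *: x + y, w) = l *: h (x, w) + h (y, w)) /\
      (forall x, multilinear (fun w => h (x, w)))
  end.

Fixpoint norm_prod (k : numFieldType) (I : Type)
  (V : I -> completeNormedModType k) (cs : seq I) :
  hprod (fun c => V c : Type) cs -> k :=
  match cs return hprod (fun c => V c : Type) cs -> k with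
  | [::] => fun _ => 1
  | c :: cs' => fun v => `|v.1| * norm_prod v.2
  end.

(* End(F_c1, ..., F_cn; F_c) in the endomorphism operad of Banach presheaves:
   natural families of bounded multilinear maps (equivalently, morphisms out of
   the objectwise projective tensor product). *)
Record ban_op (k : numFieldType) (C : category) (I : Type)
  (F : I -> banach_presheaf k C) (cs : seq I) (c : I) := BanOp {
  bop : forall a : C, hprod (fun d => F d a : Type) cs -> F c a;
  bop_multilinear : forall a,
    @multilinear k I (fun d => F d a) (F c a) cs (@bop a);
  bop_bounded : forall a, exists M : k, forall v,
    `|@bop a v| <= M * @norm_prod k I (fun d => F d a) cs v;
  bop_natural : forall b a (f : hom b a) v,
    bp_res f (@bop a v) = @bop b (hmap (fun d => @bp_res k C (F d) b a f) v)
}.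
Arguments bop {k C I F cs c} b a v : rename.

(* sys_tauE determines the covering sieves.  Conversely, that the generating
   families are the covers of a Grothendieck topology (in particular that they
   are stable under pullback) is an admissibility requirement.
   rho_id and rho_comp say that (rho_col, rho_op) is a morphism of operads from
   the synergy operad to the endomorphism operad of Banach presheaves. *)
Record opsem_system (R : realType) := OpsemSystem {
  sys_A :> operator_structure R;
  sys_sig : operator_signature sys_A;
  sys_ctx : context_category sys_A;
  sys_tau : forall C : sys_ctx, sieve C -> Prop;
  sys_tau_topology : is_topology sys_tau;
  sys_tauE : forall (C : sys_ctx) (I : Type) (D : I -> sys_ctx)
    (f : forall i, hom (D i) C),
    sys_tau (family_sieve f) <-> generating sys_sig f;
  rho_col : color sys_sig -> banach_presheaf R[i] sys_ctx;
  rho_op : forall cs c, @synop R sys_A sys_sig cs c -> ban_op rho_col cs c;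
  rho_id : forall c C v, bop (rho_op (synid c)) C v = v.1;
  rho_comp : forall cs ds e (g : @synop R sys_A sys_sig ds e)
    (F : forest (@synop R sys_A sys_sig) cs ds) C v,
    bop (rho_op (syncomp g F)) C v =
    bop (rho_op g) C
      (@forest_eval _ _ (fun d => rho_col d C : Type)
         (fun cs c o => bop (rho_op o) C) cs ds F v)
}.

(* pi c is the least context containing all operators of type c. *)
Record color_context (R : realType) (A : opsem_system R) := ColorContext {
  cc_fun :> functor (color_cat (sys_sig A)) (sys_ctx A);
  cc_eval : forall c : color (sys_sig A), optype c `<=` ctx (cc_fun c);
  cc_min : forall (c : color (sys_sig A)) (C : sys_ctx A),
    optype c `<=` ctx C -> ctx (cc_fun c) `<=` ctx C
}.

(* Functors {0 < ... < n} -> J, i.e. the n-simplices of the nerve of J. *)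
Record chain (J : category) (n : nat) := Chain {
  ch_ob : 'I_n.+1 -> J;
  ch_mor : forall i j : 'I_n.+1, (i <= j)%N -> hom (ch_ob i) (ch_ob j);
  ch_mor1 : forall (i : 'I_n.+1) (h : (i <= i)%N), ch_mor h = idh (ch_ob i);
  ch_morM : forall (i j l : 'I_n.+1) (h : (i <= j)%N) (h' : (j <= l)%N) (h'' : (i <= l)%N),
    ch_mor h'' = ch_mor h' \oc ch_mor h
}.

Definition chain_sub (J : category) m n (F : chain J n) (t : mono m n) :
  chain J m :=
  @Chain J m (fun i => ch_ob F (sval t i))
    (fun i j h => ch_mor F (proj2_sig t i j h))
    (fun i h => ch_mor1 F _) (fun i j l h h' h'' => ch_morM F _ _ _).

Definition Syn (R : realType) (A : opsem_system R) (pi : color_context A)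
  (c : color_cat (sys_sig A)) (C : sys_ctx A) : Type := hom C (pi c).

Definition Syn_map (R : realType) (A : opsem_system R) (pi : color_context A)
  (c d : color_cat (sys_sig A)) (u : hom c d) (D C : sys_ctx A) (f : hom D C)
  (s : Syn pi c C) : Syn pi d D := fmor pi u \oc (s \oc f).

Lemma chain_existT (J : category) n (T : J -> Type) (o : 'I_n.+1 -> J)
  (mo mo' : forall i j : 'I_n.+1, (i <= j)%N -> hom (o i) (o j)) m1 mM m1' mM'
  (s s' : T (o ord0)) : mo = mo' -> s = s' ->
  existT (fun F : chain J n => T (ch_ob F ord0)) (@Chain J n o mo m1 mM) s =
  existT (fun F : chain J n => T (ch_ob F ord0)) (@Chain J n o mo' m1' mM') s'.
Proof.
move=> e ->; case: _ / e m1' mM' => m1' mM'.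
by rewrite (Prop_irrelevance m1 m1') (Prop_irrelevance mM mM').
Qed.

(* The variance is the one making the extension contravariant in C.
   Lan of c |-> Syn(c) along pi as a space-valued presheaf: the homotopy colimit
   (in Bousfield-Kan form) at C of the local realizations over C, i.e. over the
   pairs of a color c and phi in Syn(c)(C) = Hom(C, pi c), the restriction along
   phi of the tautological realization in Syn(c)(pi c). *)
Definition spec_pre (R : realType) (A : opsem_system R) (pi : color_context A) :
  sPsh (sys_ctx A).
Proof.
refine (@SPsh (sys_ctx A)
  (fun C n => {F : chain (color_cat (sys_sig A)) n & Syn pi (ch_ob F ord0) C})
  (fun D C f m n t x => existT _ (chain_sub (projT1 x) t)
     (Syn_map (ch_mor (projT1 x) (leq0n (sval t ord0) : (ord0 <= _)%N)) f
        (projT2 x))) _ _).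
- move=> C n [F s]; case: F s => ob0 mo m1 mM s /=.
  apply: (@chain_existT _ n (fun c => Syn pi c C)) => //.
  rewrite /Syn_map comph1.
  have -> : mo ord0 ord0 (leq0n ord0) = idh _ by exact: m1.
  by rewrite fmor1 comp1h.
- move=> E D C f g l m n t r [F s] /=.
  apply: (@chain_existT _ l (fun c => Syn pi c E)) => //.
  rewrite /Syn_map /= !comphA -fmorM.
  by congr (fmor pi _ \oc s \oc f \oc g); exact: ch_morM.
Defined.

(* Hypersheafifications are unique up to equivalence only; this is any model. *)
Record spectral_stack (R : realType) (A : opsem_system R)
  (pi : color_context A) := SpectralStack {
  spec :> sPsh (sys_ctx A);
  spec_unit : smap (spec_pre pi) spec;
  spec_unitP : is_hypersheafification (@sys_tau R A) spec_unit
}.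

(* A compatible family of local realizations, one over each context, agreeing
   up to homotopy on restrictions. *)
Definition compatible_family (C : category) (X : sPsh C)
  (x : forall a, X a 0%N) : Prop :=
  forall b a (f : hom b a),
    @connected_to (seval X b) (sres f (x a)) (x b).

Definition local_realizations_glue (C : category) (X : sPsh C) : Prop :=
  forall x : forall a, X a 0%N, compatible_family x ->
    exists y : points X tt 0%N, forall a,
      @connected_to (seval X a) (sval y a) (x a).

(* Global points of Spec(A) that are glued from local realizations of colors:
   over every context, locally for tau, the point is homotopic to a realization
   (c, s) with s in Syn(c). *)
Definition classical_realization (R : realType) (A : opsem_system R)
  (pi : color_context A) (X : spectral_stack pi)
  (x : points X tt 0%N) : Prop :=
  forall C : sys_ctx A, exists2 S : sieve C, sys_tau S &
    forall D (f : hom D C), S D f ->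
      exists r : spec_pre pi D 0%N,
        @connected_to (seval X D) (sval x D) (spec_unit X D 0%N r).

(* The sectors are the components of the space of pairs (x, alpha), x a global
   point of the stack. *)
Definition inertia_sectors (C : category) (X : sPsh C) :
  set (set (points (inertia X) tt 0%N)) := pi0 (points (inertia X)).
Arguments inertia_sectors {_} X.

Definition only_trivial_inertia (C : category) (X : sPsh C) : Prop :=
  forall s, inertia_sectors X s ->
    exists x : points X tt 0%N, s (points_map (identity_loop X) tt 0%N x).

(* I_triv is a union of components, hence determined by its vertices. *)
Definition trivial_inertia (R : realType) (A : opsem_system R)
  (pi : color_context A) (X : spectral_stack pi) :
  set (points (inertia X) tt 0%N) :=
  \bigcup_(x in [set x | classical_realization x])
    component (points_map (identity_loop X) tt 0%N x).
Arguments trivial_inertia {_ _ _} X.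

Definition full_sub (K : sSet) (V : set (K tt 0%N)) : sSet.
Proof.
refine (@ssub _ K
  (fun o n => match o return K o n -> Prop with
    tt => fun x => forall i : 'I_n.+1, V (sop (mono_cst 0 i) x) end) _).
move=> [] [] [] m n t x Vx i.
rewrite /sop -sactM.
have -> : mono_comp t (mono_cst 0 i) = mono_cst 0 (sval t i) by exact: sig_ext.
exact: Vx.
Defined.

Definition nontrivial_inertia (R : realType) (A : opsem_system R)
  (pi : color_context A) (X : spectral_stack pi) : sSet :=
  full_sub (~` trivial_inertia X).

(* Valued in the extended reals: +oo when there are infinitely many components. *)
Definition ctx_deg_red (R : realType) (A : opsem_system R)
  (pi : color_context A) (X : spectral_stack pi) : \bar R :=
  counting (pi0 (nontrivial_inertia X)).

Definition is_commutative (R : realType) (A : opsem_system R) : Prop :=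
  commuting (@operators R A).

Record set_presheaf (C : category) := SetPresheaf {
  pf :> C -> Type;
  pf_res : forall b a (f : hom b a), pf a -> pf b;
  pf_res1 : forall a x, pf_res (idh a) x = x;
  pf_resM : forall c b a (f : hom b a) (g : hom c b) x,
    pf_res (f \oc g) x = pf_res g (pf_res f x)
}.

Definition is_sheaf (C : category) (tau : forall a : C, sieve a -> Prop)
  (F : set_presheaf C) : Prop :=
  forall (a : C) (S : sieve a), tau a S ->
  forall x : forall b (f : hom b a), S b f -> F b,
    (forall b (f : hom b a) (Sf : S b f) c (g : hom c b) (Sfg : S c (f \oc g)),
       pf_res g (x b f Sf) = x c (f \oc g) Sfg) ->
    exists! y : F a, forall b (f : hom b a) (Sf : S b f),
      pf_res f y = x b f Sf.

Definition discrete (C : category) (F : set_presheaf C) : sPsh C :=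
  @SPsh C (fun a _ => F a) (fun b a f _ _ _ x => pf_res f x)
    (fun a _ x => pf_res1 x) (fun c b a f g _ _ _ _ _ x => pf_resM f g x).

Definition is_zero_stack (C : category) (tau : forall a : C, sieve a -> Prop)
  (X : sPsh C) : Prop :=
  exists2 F : set_presheaf C, is_sheaf tau F &
    exists h : smap X (discrete F), homotopy_equivalence h.

(* Main.v *)
From Stdlib Require Import Relations.
From Pilot Require Import Defs.
From mathcomp Require Import all_boot all_order all_algebra.
From mathcomp Require Import all_classical all_reals all_analysis.

Import Pilot.Defs.

(** The trivial part of the inertia is spanned by the identity loops at the
    classical global points, those which are locally homotopic to a realization
    of a color, whereas having only trivial inertia sectors provides in each
    sector an identity loop at some global point.  What has to be shown is that
    every global point is classical.  This is the local surjectivity on pi_0 of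
    the unit eta : P -> X of a hypersheafification, and it has to come from the
    universal property ([hypersheafification_unit_surj]).

    Let X' be the part of X spanned by the vertices that are, locally, in the
    component of a vertex of eta.  It is a union of components of X, stable
    under restriction, and membership in it is a local condition.  Such a part
    of a hypersheaf is again a hypersheaf ([ci_hypersheaf]): a map into X lands
    in X' as soon as it does so on one vertex of each component, so that lifts,
    homotopies and descent data for X that start in X' stay in X'.  Now eta
    factors through X', and the universal property for maps into X' extends the
    factorization to r : X -> X'.  Restricted along eta, the composite
    X -> X' -> X and the identity become homotopic, hence they are homotopic,
    and every vertex x of X is connected to r x, which lies in X'.

    So all sectors are trivial sectors, the complement of the trivial inertia
    is empty and the degree vanishes ([trivial_inertia_ctx_deg]).

    A 0-stack has only trivial inertia sectors: it is homotopy equivalent to a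
    discrete presheaf, in which a loop is constant ([discrete_loop]), and a
    homotopy between f and g connects the images of a loop under f and g in the
    inertia ([inertia_map_connected]). *)

Set Implicit Arguments.
Unset Strict Implicit.
Unset Printing Implicit Defensive.

Local Open Scope classical_set_scope.
Local Open Scope ereal_scope.

(** * Simplices, vertices and connectedness *)

Lemma mono0_eq m (s t : mono m 0) : s = t.
Proof. by apply: sig_ext; apply/funext => j; rewrite !ord1. Qed.

Lemma mono_cstE n (s : mono 0 n) : s = mono_cst 0 (sval s ord0).
Proof. by apply: sig_ext; apply/funext => j; rewrite /= ord1. Qed.

Lemma mono_comp1 m n (s : mono m n) : mono_comp (mono_id n) s = s.
Proof. exact: sig_ext. Qed.

Lemma smap_nat (C : category) (P Q : sPsh C) (h : smap P Q) b a (f : hom b a)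
  m n (t : mono m n) (x : P a n) : h b m (sact P f t x) = sact Q f t (h a n x).
Proof. exact (proj2_sig h b a f m n t x). Qed.

Lemma smap_sop (C : category) (P Q : sPsh C) (h : smap P Q) a
  m n (t : mono m n) (x : P a n) : h a m (sop t x) = sop t (h a n x).
Proof. exact: smap_nat. Qed.

Lemma smap_sres (C : category) (P Q : sPsh C) (h : smap P Q) b a (f : hom b a)
  n (x : P a n) : h b n (sres f x) = sres f (h a n x).
Proof. exact: smap_nat. Qed.

Lemma sop_comp (C : category) (X : sPsh C) (a : C) l m n (t : mono m n)
  (s : mono l m) (x : X a n) : sop s (sop t x) = sop (mono_comp t s) x.
Proof. by rewrite /sop -sactM comph1. Qed.

Lemma sop1 (C : category) (X : sPsh C) (a : C) n (x : X a n) :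
  sop (mono_id n) x = x.
Proof. exact: sact1. Qed.

Lemma sres_comp (C : category) (X : sPsh C) (c b a : C) (f : hom b a)
  (g : hom c b) n (x : X a n) : sres g (sres f x) = sres (f \oc g) x.
Proof. by rewrite /sres -sactM mono_comp1. Qed.

Lemma sres1 (C : category) (X : sPsh C) (a : C) n (x : X a n) :
  sres (idh a) x = x.
Proof. exact: sact1. Qed.

Local Notation vertex j := (sop (mono_cst 0 j)).

Lemma vertex_sop (C : category) (X : sPsh C) (a : C) m n (t : mono m n) j
  (x : X a n) : vertex j (sop t x) = vertex (sval t j) x.
Proof. by rewrite sop_comp; congr sop; exact: sig_ext. Qed.

Lemma connected_sym (K : sSet) (x y : K tt 0%N) :
  connected_to x y -> connected_to y x.
Proof. exact: rst_sym. Qed.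

Lemma connected_trans (K : sSet) (x y z : K tt 0%N) :
  connected_to x y -> connected_to y z -> connected_to x z.
Proof. exact: rst_trans. Qed.

Lemma connected_smap (K L : sSet) (f : smap K L) (x y : K tt 0%N) :
  connected_to x y -> connected_to (f tt 0%N x) (f tt 0%N y).
Proof.
elim=> {x y} [x y [e [<- <-]]|x|x y _|x y z _ xy _ yz].
- by apply: rst_step; exists (f tt 1%N e); rewrite !smap_sop.
- exact: rst_refl.
- exact: rst_sym.
- exact: rst_trans xy yz.
Qed.

Lemma connected_seval (C : category) (P Q : sPsh C) (f : smap P Q) a
  (x y : P a 0%N) : connected_to (K := seval P a) x y ->
  connected_to (K := seval Q a) (f a 0%N x) (f a 0%N y).
Proof. exact: (connected_smap (seval_map f a)). Qed.

Lemma connected_sres (C : category) (X : sPsh C) (b a : C) (f : hom b a)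
  (x y : X a 0%N) : connected_to (K := seval X a) x y ->
  connected_to (K := seval X b) (sres f x) (sres f y).
Proof. exact: (connected_smap (seval_res X f)). Qed.

Lemma is_mono_edge n (j k : 'I_n.+1) : (j <= k)%N ->
  is_mono (fun i : 'I_2 => if i == ord0 then j else k).
Proof.
move=> jk u v; case: (I2_cases u) => ->; case: (I2_cases v) => -> //=.
Qed.

Lemma vertices_connected (K : sSet) n (x : K tt n) (j k : 'I_n.+1) :
  connected_to (vertex j x) (vertex k x).
Proof.
wlog jk : j k / (j <= k)%N => [hw|].
  by case/orP: (leq_total j k) => /hw // h; exact: connected_sym.
apply: rst_step; exists (sop (exist (@is_mono 1 n) _ (is_mono_edge jk)) x).
by rewrite !vertex_sop.
Qed.

(** Both vertices lie on the image under [H] of the n-simplex obtained from the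
    degeneracy of [x] and the identity of the standard simplex. *)
Lemma cylinder_connected (C : category) (P Q : sPsh C) n
  (H : smap (sprod P (scst C (simplex n))) Q) a (x : P a 0%N) (j k : 'I_n.+1) :
  connected_to (K := seval Q a) (H a 0%N (x, mono_cst 0 j))
                                (H a 0%N (x, mono_cst 0 k)).
Proof.
have HE i : H a 0%N (x, mono_cst 0 i) =
    vertex i (H a n (sop (mono_cst n ord0) x, mono_id n)).
  rewrite -smap_sop; congr (H a 0%N _).
  rewrite /sop /=; congr (_, _).
  rewrite -sactM comph1 -[LHS]sact1; congr (sact P _ _ _); exact: mono0_eq.
by rewrite !HE; exact: (@vertices_connected (seval Q a)).
Qed.

Lemma homotopic_connected (C : category) (P Q : sPsh C) (f g : smap P Q) a
  (x : P a 0%N) : homotopic f g ->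
  connected_to (K := seval Q a) (f a 0%N x) (g a 0%N x).
Proof.
elim=> {f g} [f g [H [H0 H1]]|f|f g _|f g h _ fg _ gh].
- by rewrite -H0 -H1; exact: cylinder_connected.
- exact: rst_refl.
- exact: rst_sym.
- exact: rst_trans fg gh.
Qed.

Lemma sMap_connected (C : category) (P Q : sPsh C) (u v : sMap P Q tt 0%N)
  a (x : P a 0%N) (s : mono 0 0) : connected_to u v ->
  connected_to (K := seval Q a) ((u : smap _ _) a 0%N (x, s))
                                ((v : smap _ _) a 0%N (x, s)).
Proof.
elim=> {u v} [u v [e [<- <-]]|u|u v _|u v w _ uv _ vw].
- have eE (i : 'I_2) : ((sop (mono_cst 0 i) e : sMap P Q tt 0%N) : smap _ _)
      a 0%N (x, s) = (e : smap _ _) a 0%N (x, mono_cst 0 i).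
    by rewrite /sapp /=; congr (sval e a 0%N (_, _)); exact: sig_ext.
  by rewrite !eE; exact: cylinder_connected.
- exact: rst_refl.
- exact: rst_sym.
- exact: rst_trans uv vw.
Qed.

Lemma homotopic_pre (C : category) (P Q S : sPsh C) (h : smap P Q)
  (f g : smap Q S) : homotopic f g -> homotopic (scomp f h) (scomp g h).
Proof.
elim=> {f g} [f g [H [H0 H1]]|f|f g _|f g k _ fg _ gk].
- apply: rst_step; exists (scomp H (sprod_map h (sid _))).
  by split=> a n x; [exact: H0 | exact: H1].
- exact: rst_refl.
- exact: rst_sym.
- exact: rst_trans fg gk.
Qed.

(** * Unions of components *)

(** A presheaf that is, over each object, a union of components.  Asking that
    one vertex of a simplex be in the image is what makes the image a full
    subobject and closes it under edges at the same time. *)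
Record component_inclusion (C : category) (Q' Q : sPsh C) (i : smap Q' Q) :
  Prop := ComponentInclusion {
  ci_inj : forall a n, injective (i a n);
  ci_range : forall a n (y : Q a n) (j : 'I_n.+1),
    range (i a 0%N) (vertex j y) -> range (i a n) y
}.

Lemma ci_connected (C : category) (Q' Q : sPsh C) (i : smap Q' Q) a
  (x y : Q a 0%N) : component_inclusion i ->
  connected_to (K := seval Q a) x y -> range (i a 0%N) x <-> range (i a 0%N) y.
Proof.
move=> iP; elim=> {x y} [x y [e [<- <-]]|x|x y _|x y z _ xy _ yz].
- have h (j k : 'I_2) : range (i a 0%N) (vertex j (e : Q a 1%N)) ->
      range (i a 0%N) (vertex k (e : Q a 1%N)).
    move=> /(ci_range iP)[z _ <-]; exists (vertex k z) => //.
    exact: smap_sop.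
  by split; exact: h.
- by [].
- by move=> [].
- by split=> [/xy/yz|/yz/xy].
Qed.

(** Only vertices have to be tested, because each simplex has one; uniqueness
    of the lifts makes their choice natural. *)
Lemma ci_lift (C : category) (P Q' Q : sPsh C) (i : smap Q' Q) (F : smap P Q) :
  component_inclusion i ->
  (forall a (x : P a 0%N), range (i a 0%N) (F a 0%N x)) ->
  exists F' : smap P Q', scomp i F' = F.
Proof.
move=> iP Fi.
have h a n (x : P a n) : {y | i a n y = F a n x}.
  apply: cid; have [|y _ yE] := @ci_range _ _ _ _ iP a n (F a n x) ord0.
    by rewrite -smap_sop.
  by exists y.
have nat_h : is_natural (fun a n x => sval (h a n x)).
  move=> b a f m n t x; apply: (@ci_inj _ _ _ _ iP).
  by rewrite (proj2_sig (h _ _ _)) smap_nat smap_nat (proj2_sig (h _ _ _)).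
exists (mksmap _ nat_h); apply: smap_ext => a n x.
exact: proj2_sig (h a n x).
Qed.

(** The cylinder connects each vertex to one on the face [j], so it suffices to
    test that face.  This serves both for homotopies (n = 1) and for simplices
    of mapping spaces. *)
Lemma ci_lift_cylinder (C : category) (P Q' Q : sPsh C) (i : smap Q' Q) n
  (H : smap (sprod P (scst C (simplex n))) Q) (j : 'I_n.+1) :
  component_inclusion i ->
  (forall a (x : P a 0%N), range (i a 0%N) (H a 0%N (x, mono_cst 0 j))) ->
  exists H' : smap (sprod P (scst C (simplex n))) Q', scomp i H' = H.
Proof.
move=> iP Hj; apply: ci_lift => // a [x s].
rewrite (mono_cstE s); apply/(ci_connected iP); last exact: Hj.
exact: cylinder_connected.
Qed.

Lemma ci_mono (C : category) (P Q' Q : sPsh C) (i : smap Q' Q)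
  (f g : smap P Q') :
  component_inclusion i -> scomp i f = scomp i g -> f = g.
Proof.
move=> iP fg; apply: smap_ext => a n x; apply: (ci_inj iP).
exact: (congr1 (fun h : smap P Q => h a n x) fg).
Qed.

(** This lets statements about [sMap P Q'] be checked in [sMap P Q], where the
    cylinder on a simplex supplies the other vertices from one of them. *)
Lemma ci_sMap (C : category) (P Q' Q : sPsh C) (i : smap Q' Q) :
  component_inclusion i -> component_inclusion (sMap_post P i).
Proof.
move=> iP; split=> [[] n h k|[] n H j [h _ hE]]; first exact: ci_mono.
have [|H' HE] := @ci_lift_cylinder _ _ _ _ i n H j iP; last by exists H'.
move=> a x; exists ((h : smap _ _) a 0%N (x, mono_id 0)) => //.
apply: etrans (congr1 (fun k : smap (sprod P (scst C (simplex 0))) Q =>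
  k a 0%N (x, mono_id 0)) hE) _.
rewrite /sapp /=; congr (sval H a 0%N (_, _)).
Qed.

(** A chain of elementary homotopies which starts in the image of [i] stays in
    it, so that the whole chain lifts. *)
Lemma ci_homotopic (C : category) (P Q' Q : sPsh C) (i : smap Q' Q)
  (f g : smap P Q') : component_inclusion i ->
  homotopic (scomp i f) (scomp i g) -> homotopic f g.
Proof.
move=> iP.
(* A homotopy lifts together with the end [j] from which the lift starts. *)
have half (F G : smap P Q) (j k : 'I_2)
    (H : smap (sprod P (scst C (simplex 1))) Q) :
    (forall a n x, H a n (x, mono_cst n j) = F a n x) ->
    (forall a n x, H a n (x, mono_cst n k) = G a n x) ->
    forall F', scomp i F' = F ->
    exists H' : smap (sprod P (scst C (simplex 1))) Q',
     (forall a n x, H' a n (x, mono_cst n j) = F' a n x) /\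
     exists2 G', scomp i G' = G &
       forall a n x, H' a n (x, mono_cst n k) = G' a n x.
  move=> Hj Hk F' FE.
  have [|H' HE] := @ci_lift_cylinder _ _ _ _ i 1 H j iP.
    by move=> a x; rewrite Hj -FE; exists (F' a 0%N x).
  have HE' a n x : i a n (H' a n x) = H a n x by rewrite -HE.
  exists H'; split.
    by move=> a n x; apply: (ci_inj iP); rewrite HE' Hj -FE.
  have Gnat : is_natural (fun a n x => H' a n (x, mono_cst n k)).
    move=> b a u m n t x; rewrite -smap_nat; congr (H' b m (_, _)).
  exists (mksmap _ Gnat) => //; apply: smap_ext => a n x.
  by rewrite -Hk -HE'.
(* The symmetry steps of a chain force both directions into the induction. *)
suff main (F G : smap P Q) : homotopic F G ->
    (forall F', scomp i F' = F -> exists2 G', scomp i G' = G & homotopic F' G')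
    /\
    (forall G', scomp i G' = G -> exists2 F', scomp i F' = F & homotopic F' G').
  move=> /main[+ _] => /(_ f erefl)[g' gg' fg'].
  by rewrite -(ci_mono iP gg').
elim=> {F G f g} [F G [H [H0 H1]]|F|F G _ [FG GF]|F G K _ [FG GF] _ [GK KG]].
- split=> [F' FE|G' GE].
    have [H' [H'0 [G' GE H'1]]] := half _ _ _ _ _ H0 H1 _ FE.
    by exists G' => //; apply: rst_step; exists H'.
  have [H' [H'1 [F' FE H'0]]] := half _ _ _ _ _ H1 H0 _ GE.
  by exists F' => //; apply: rst_step; exists H'.
- by split=> F' FE; exists F' => //; exact: rst_refl.
- split=> [G' /GF[F' FE h]|F' /FG[G' GE h]].
    by exists F' => //; exact: rst_sym.
  by exists G' => //; exact: rst_sym.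
- split=> [F' /FG[G' /GK[K' KE h2] h1]|K' /KG[G' /GF[F' FE h2] h1]].
    by exists K' => //; exact: rst_trans h1 h2.
  by exists F' => //; exact: rst_trans h2 h1.
Qed.

(** All vertices of a simplex are connected, so the simplices whose vertices all
    satisfy [V] are also those with one vertex that does. *)
Lemma component_sub (C : category) (X : sPsh C) (V : forall a, set (X a 0%N)) :
  (forall b a (f : hom b a) x, V a x -> V b (sres f x)) ->
  (forall a x y, connected_to (K := seval X a) x y -> V a x -> V a y) ->
  exists (X' : sPsh C) (i : smap X' X), component_inclusion i /\
    forall a x, range (i a 0%N) x <-> V a x.
Proof.
move=> Vres Vconn.
have VP b a (f : hom b a) m n (t : mono m n) (x : X a n) :
    (forall j, V a (vertex j x)) -> forall j, V b (vertex j (sact X f t x)).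
  move=> Vx j; have -> : vertex j (sact X f t x) = sres f (vertex (sval t j) x).
    rewrite /sop /sres -!sactM comph1 comp1h; congr (sact X f _ x).
    exact: sig_ext.
  exact: Vres.
pose i : smap (ssub VP) X :=
  @mksmap C (ssub VP) X (fun _ _ x => sval x) (fun _ _ _ _ _ _ _ => erefl).
have vE a (x : X a 0%N) j : vertex j x = x.
  by rewrite (_ : mono_cst 0 j = mono_id 0) ?sop1 //; exact: mono0_eq.
exists (ssub VP), i; split; last first.
  move=> a x; split=> [[[y Vy] _ <-]|Vx].
    by have := Vy ord0; rewrite vE.
  have Vx' j : V a (vertex j x) by rewrite vE.
  by exists (exist _ x Vx').
split=> [a n x y /sig_ext //|a n y j [[z Vz] _ zE]].
have Vy k : V a (vertex k y).
  apply: (Vconn _ (vertex j y)); first exact: (@vertices_connected (seval X a)).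
  by have := Vz ord0; rewrite vE -zE.
by exists (exist _ y Vy).
Qed.

(** * Weak equivalences are surjective on components *)

Lemma sop_discrete (C : category) (F : set_presheaf C) (a : C) m n
  (t : mono m n) (x : discrete F a n) : sop t x = x :> F a.
Proof. exact: pf_res1. Qed.

Lemma connected_discrete (C : category) (F : set_presheaf C) (a : C)
  (x y : F a) :
  connected_to (K := seval (discrete F) a) x y -> x = y.
Proof.
elim=> {x y} [x y [e [<- <-]]|x|x y _|x y z _ xy _ yz] //.
- by rewrite xy yz.
Qed.

Lemma connected_discrete_set (F : set_presheaf point_cat) (x y : F tt) :
  connected_to (K := discrete F) x y -> x = y.
Proof. exact: (@connected_discrete _ F tt). Qed.

Definition horn_simplex n (k : 'I_n.+1) m (s : mono m n)
  (sk : exists2 i, i <> k & forall j, sval s j <> i) : horn k tt m :=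
  exist (fun s : mono m n => exists2 i, i <> k & forall j, sval s j <> i) s sk.

(** If the simplex [s] misses the vertex [i], then its first vertex and [k] both
    differ from [i], so that the edge between them lies in the horn. *)
Lemma horn_connected n (k : 'I_n.+1) m (s : horn k tt m) (kk : horn k tt 0%N) :
  sval kk = mono_cst 0 k -> connected_to (vertex ord0 s) kk.
Proof.
move=> kE; have [i ik si] := proj2_sig s.
pose j := sval (sval s : mono m n) ord0.
have ji : j <> i by exact: si.
have edge_horn (u v : 'I_n.+1) (uv : (u <= v)%N) : u <> i -> v <> i ->
    exists e : horn k tt 1%N,
      sval e = exist (@is_mono 1 n) _ (is_mono_edge uv).
  move=> ui vi.
  have eP : exists2 i, i <> k &
      forall l, sval (exist (@is_mono 1 n) _ (is_mono_edge uv)) l <> i.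
    by exists i => // l /=; case: ifP.
  by exists (horn_simplex eP).
case/orP: (leq_total j k) => jk; [|apply: connected_sym]; apply: rst_step.
- have [e eE] := edge_horn _ _ jk ji (nesym ik).
  by exists e; split; apply: sig_ext; rewrite ?kE /= eE; exact: sig_ext.
- have [e eE] := edge_horn _ _ jk (nesym ik) ji.
  by exists e; split; apply: sig_ext; rewrite ?kE /= eE; exact: sig_ext.
Qed.

Lemma discrete_kan (F : set_presheaf point_cat) : is_kan (discrete F).
Proof.
move=> n k n0 h.
have kP : exists2 i, i <> k & forall j, sval (mono_cst 0 k) j <> i.
  (* k itself is a simplex of the horn because n > 0 leaves another vertex *)
  have [i ik] : exists i : 'I_n.+1, i <> k.
    case: (eqVneq k ord0) => [->|/eqP]; last by exists ord0 => /esym.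
    by exists ord_max; case: n {k h} n0 => // n _ /(congr1 val).
  by exists i => // j; exact: nesym.
pose kk : horn k tt 0%N := horn_simplex kP.
exists (h tt 0%N kk) => m s; rewrite sop_discrete.
have /(connected_smap h)/connected_discrete_set <- :=
  horn_connected s (kk := kk) erefl.
by rewrite smap_sop sop_discrete.
Qed.

(** As a discrete simplicial set: maps from K into it are subsets of pi_0 K. *)
Definition Prop_presheaf : set_presheaf point_cat :=
  @SetPresheaf point_cat (fun _ => Prop) (fun _ _ _ x => x)
    (fun _ _ => erefl) (fun _ _ _ _ _ _ => erefl).

(** The indicator of the components that meet the image of [f] and the constant
    map [True] agree after composition with [f].  Their common target is a Kan
    complex, so they are homotopic, and equal since the target is discrete. *)
Lemma weak_equivalence_pi0 (K L : sSet) (f : smap K L) (y : L tt 0%N) :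
  weak_equivalence f -> exists x : K tt 0%N, connected_to (f tt 0%N x) y.
Proof.
move=> /(_ _ (@discrete_kan Prop_presheaf))[_ finj].
pose ind (a : point_cat) n : L a n -> Prop :=
  match a return L a n -> Prop with tt => fun z =>
    exists x : K tt 0%N, connected_to (f tt 0%N x) (vertex ord0 z) end.
have ind_nat : @is_natural _ L (discrete Prop_presheaf) ind.
  move=> [] [] [] m n t z /=; apply/propext.
  have zz : connected_to (vertex ord0 (sop t z)) (vertex ord0 z).
    by rewrite vertex_sop; exact: vertices_connected.
  split=> -[x xz]; exists x; first exact: connected_trans xz zz.
  exact: connected_trans xz (connected_sym zz).
have true_nat : @is_natural _ L (discrete Prop_presheaf) (fun _ _ _ => True).
  by [].
have e : homotopic (scomp (mksmap _ ind_nat) f) (scomp (mksmap _ true_nat) f).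
  rewrite (_ : scomp (mksmap _ ind_nat) f = scomp (mksmap _ true_nat) f).
    exact: rst_refl.
  apply: smap_ext => -[] n x; apply/propext; split=> // _ /=.
  exists (vertex ord0 x); rewrite smap_sop; exact: rst_refl.
have /connected_discrete :=
  @homotopic_connected point_cat _ _ _ _ tt y (finj _ _ e).
rewrite /sapp /= => yT.
have [x xy] : ind tt 0%N y by rewrite /ind yT.
exists x; move: xy; rewrite (_ : mono_cst 0 ord0 = mono_id 0) ?sop1 //.
exact: mono0_eq.
Qed.

(** * Unions of components in hypersheaves *)

Lemma scompA (C : category) (P Q S T : sPsh C) (h : smap S T) (g : smap Q S)
  (f : smap P Q) : scomp h (scomp g f) = scomp (scomp h g) f.
Proof. exact: smap_ext. Qed.

Lemma scomp1s (C : category) (P Q : sPsh C) (f : smap P Q) :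
  scomp (sid Q) f = f.
Proof. exact: smap_ext. Qed.

Lemma scomps1 (C : category) (P Q : sPsh C) (f : smap P Q) :
  scomp f (sid P) = f.
Proof. exact: smap_ext. Qed.

Lemma sMap_pre_post (C : category) (P P' Q Q' : sPsh C) (p : smap P P')
  (q : smap Q Q') :
  scomp (sMap_pre Q' p) (sMap_post P' q) = scomp (sMap_post P q) (sMap_pre Q p).
Proof. by apply: smap_ext => u n h; exact: smap_ext. Qed.

(** An extension to [L] of a map that lands in the part [X'] lands there too,
    because each vertex of [L] is connected to one coming from [K]. *)
Lemma ci_fibrant (C : category) (X' X : sPsh C) (i : smap X' X) :
  component_inclusion i -> injectively_fibrant X -> injectively_fibrant X'.
Proof.
move=> iP Xfib K L j j_inj j_we k.
have [l lE] := Xfib K L j j_inj j_we (scomp i k).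
have [a y|l' l'E] := ci_lift (F := l) iP.
  have [x /(connected_seval l) xy] :=
    @weak_equivalence_pi0 _ (seval L a) _ y (j_we a).
  apply/(ci_connected iP xy); exists (k a 0%N x) => //.
  exact (congr1 (fun h : smap K X => h a 0%N x) (esym lE)).
by exists l'; apply: (ci_mono iP); rewrite scompA l'E.
Qed.

Lemma boundary0 (m : nat) : boundary 0 tt m -> False.
Proof. by case=> s [i /(_ ord0)]; rewrite !ord1. Qed.

(** The 0-dimensional part of the hypercover condition, in which the boundary is
    empty. *)
Lemma hypercover_vertex (C : category) (tau : forall a : C, sieve a -> Prop)
  (a : C) (U : sPsh C) (p : smap U (representable a)) b (f : hom b a) :
  is_hypercover tau p -> exists2 S : sieve b, tau b S &
    forall c (g : hom c b), S c g -> exists u : U c 0%N, p c 0%N u = f \oc g.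
Proof.
pose d (o : point_cat) m : boundary 0 o m -> seval U b o m :=
  match o with tt => fun s => False_rect _ (boundary0 s) end.
have d_nat : is_natural d by move=> [] [] [] m n t s; case: (boundary0 s).
move=> /(_ 0%N b f (mksmap _ d_nat))[m s|S tauS SU].
  by case: (boundary0 s).
exists S => // c g /SU[u [pu _]]; by exists u.
Qed.

(** Descent for [X'] is descent for [X] restricted to unions of components.  The
    homotopy inverse [g] of restriction along the hypercover [p] preserves maps
    into [X']: if [u] lands in [X'], then [g u] is connected to [u] on the
    elements of the form [p w]; these exist locally, and membership in [X'] is
    local. *)
Lemma ci_hypersheaf (C : category) (tau : forall a : C, sieve a -> Prop)
  (X' X : sPsh C) (i : smap X' X) : component_inclusion i ->
  (forall a (S : sieve a) (x : X a 0%N), tau a S ->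
    (forall b (f : hom b a), S b f -> range (i b 0%N) (sres f x)) ->
    range (i a 0%N) x) ->
  is_hypersheaf tau X -> is_hypersheaf tau X'.
Proof.
move=> iP i_local [Xfib Xdesc]; split; first exact: ci_fibrant iP Xfib.
move=> a U p pU; have [g [gp pg]] := Xdesc a U p pU.
have [|g' g'E] := @ci_lift _ _ _ _ _ (scomp g (sMap_post U i))
    (ci_sMap (representable a) iP).
  move=> [] u; set v : sMap _ X tt 0%N := _ u.
  have [b f|v' v'E] := @ci_lift_cylinder _ _ _ _ i 0 v ord0 iP;
    last by exists v'.
  have [S tauS SU] := hypercover_vertex f pU.
  apply: (i_local _ _ _ tauS) => c h /SU[w pw].
  rewrite -smap_sres.
  have -> : sres h ((f, mono_cst 0 ord0) :
      sprod (representable a) (scst C (simplex 0)) b 0%N) =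
      (p c 0%N w, mono_cst 0 ord0).
    by rewrite pw; congr (_, _).
  have /(sMap_connected w (mono_cst 0 ord0)) :=
    @homotopic_connected point_cat _ _ _ _ tt (sMap_post U i tt 0%N u) pg.
  move=> /(ci_connected iP) /= vu; apply/vu.
  by exists ((u : smap _ _) c 0%N (w, mono_cst 0 ord0)).
exists g'; split.
- apply: (ci_homotopic (ci_sMap _ iP)).
  rewrite scompA g'E -scompA -sMap_pre_post scompA scomps1.
  by rewrite -[X in homotopic _ X]scomp1s; exact: homotopic_pre.
- apply: (ci_homotopic (ci_sMap _ iP)).
  rewrite scompA -sMap_pre_post -scompA g'E scompA scomps1.
  by rewrite -[X in homotopic _ X]scomp1s; exact: homotopic_pre.
Qed.

(** * Local surjectivity of the unit of a hypersheafification *)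

Lemma sieve_ext (C : category) (a : C) (S T : sieve a) :
  (forall b (f : hom b a), S b f <-> T b f) -> S = T.
Proof.
case: S T => [S SP] [T TP] /= ST.
have e : S = T.
  apply: functional_extensionality_dep => b; apply/funext => f.
  exact/propext.
by case: _ / e TP {ST} => TP; congr Sieve; exact: Prop_irrelevance.
Qed.

Lemma topology_sup (C : category) (tau : forall a : C, sieve a -> Prop)
  (a : C) (S T : sieve a) : is_topology tau -> tau a S ->
  (forall b (f : hom b a), S b f -> T b f) -> tau a T.
Proof.
move=> tauP tauS ST; apply: (top_trans tauP tauS) => b f /ST Tf.
rewrite (_ : pullback_sieve f T = max_sieve b); first exact: top_max.
by apply: sieve_ext => c g; split=> // _; exact: insieve_comp.
Qed.

Lemma realization_closed (C : category) (P X : sPsh C) (eta : smap P X) a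
  (x : X a 0%N) b c (f : hom b a) (g : hom c b) :
  (exists r : P b 0%N,
    connected_to (K := seval X b) (sres f x) (eta b 0%N r)) ->
  exists r : P c 0%N,
    connected_to (K := seval X c) (sres (f \oc g) x) (eta c 0%N r).
Proof.
move=> [r xr]; exists (sres g r); rewrite smap_sres -sres_comp.
exact: connected_sres.
Qed.

Definition realization_sieve (C : category) (P X : sPsh C) (eta : smap P X) a
  (x : X a 0%N) : sieve a :=
  @Sieve C a (fun b f => exists r : P b 0%N,
    connected_to (K := seval X b) (sres f x) (eta b 0%N r))
    (@realization_closed C P X eta a x).

(** Vertices of a mapping space are maps out of a product with the point, whence
    the projection. *)
Definition map_vertex (C : category) (P Q : sPsh C) (f : smap P Q) :
  sMap P Q tt 0%N :=
  @mksmap C (sprod P (scst C (simplex 0))) Q (fun a n x => f a n x.1)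
    (fun b a g m n t x => smap_nat f g t x.1).

(** The vertices [x] for which the sieve is covering span a sub-hypersheaf [X']
    through which [eta] factors.  By the universal property the identity of [X]
    factors through [X'] up to homotopy, hence [X'] meets all components. *)
Lemma hypersheafification_unit_surj (C : category)
  (tau : forall a : C, sieve a -> Prop) (P X : sPsh C) (eta : smap P X) :
  is_topology tau -> is_hypersheafification tau eta ->
  forall a (x : X a 0%N), tau a (realization_sieve eta x).
Proof.
move=> tauP [Xsheaf eta_univ].
pose V a : set (X a 0%N) := fun x => tau a (realization_sieve eta x).
have Vres b a (f : hom b a) x : V a x -> V b (sres f x).
  move=> /(top_stable tauP f); rewrite /V; congr (tau b _).
  by apply: sieve_ext => c g /=; rewrite sres_comp.
have Vconn a x y : connected_to (K := seval X a) x y -> V a x -> V a y.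
  move=> xy Vx; apply: topology_sup Vx _ => // b f [r xr]; exists r.
  exact: connected_trans (connected_sym (connected_sres f xy)) xr.
have Vlocal a (S : sieve a) x : tau a S ->
    (forall b (f : hom b a), S b f -> V b (sres f x)) -> V a x.
  move=> tauS Sx; apply: (top_trans tauP tauS) => b f /Sx; rewrite /V.
  by congr (tau b _); apply: sieve_ext => c g /=; rewrite sres_comp.
have Veta a r : V a (eta a 0%N r).
  apply: topology_sup (top_max tauP a) _ => // b f _; exists (sres f r).
  by rewrite smap_sres; exact: rst_refl.
have [X' [i [iP iV]]] := component_sub Vres Vconn.
have X'sheaf : is_hypersheaf tau X'.
  apply: (ci_hypersheaf iP) Xsheaf => a S x tauS Sx; apply/iV.
  by apply: Vlocal tauS _ => b f Sf; apply/iV; exact: Sx.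
have [eta' etaE] := ci_lift (F := eta) iP (fun a r => (iV _ _).2 (Veta a r)).
have [g [_ gP]] := eta_univ X' X'sheaf.
(* r restricts along eta to the factorization eta', up to homotopy. *)
have r_eta := @homotopic_connected point_cat _ _ _ _ tt (map_vertex eta') gP.
set r : sMap X X' tt 0%N := g tt 0%N (map_vertex eta').
have [g' [g'P _]] := eta_univ X Xsheaf.
have /(connected_smap g') H : connected_to
    (sMap_pre X eta tt 0%N (sMap_post X i tt 0%N r))
    (sMap_pre X eta tt 0%N (map_vertex (sid X))).
  have -> : sMap_pre X eta tt 0%N (map_vertex (sid X)) =
      sMap_post P i tt 0%N (map_vertex eta').
    by rewrite /= -etaE; exact: smap_ext.
  have -> : sMap_pre X eta tt 0%N (sMap_post X i tt 0%N r) =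
      sMap_post P i tt 0%N (sMap_pre X' eta tt 0%N r) by exact: smap_ext.
  exact: (connected_smap (sMap_post P i)) r_eta.
have ret u := @homotopic_connected point_cat _ _ _ _ tt u g'P.
have ir_id : connected_to (sMap_post X i tt 0%N r) (map_vertex (sid X)).
  apply: connected_trans (connected_sym (ret _)) _.
  exact: connected_trans H (ret _).
move=> a x; apply: (Vconn a _ x) (sMap_connected x (mono_id 0) ir_id) _.
by apply/iV; exists ((r : smap _ _) a 0%N (x, mono_id 0)).
Qed.

(** * Inertia of discrete presheaves and homotopy invariance *)

Definition inertia_map (C : category) (X Y : sPsh C) (h : smap X Y) :
  smap (inertia X) (inertia Y).
Proof.
refine (@mksmap C (inertia X) (inertia Y)
  (fun a n l => scomp (seval_map h a) (l : smap _ _)) _).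
move=> b a f m n t l; apply: smap_ext => o k y.
exact: (smap_sres h).
Defined.

Definition loop_at (C : category) (X : sPsh C) a n (l : inertia X a n) o m
  (y : circle o m * mono m n) : X a m := (l : smap _ _) o m y.

Lemma loop_at_sres (C : category) (X : sPsh C) (b a : C) (f : hom b a) n
  (l : inertia X a n) o m (y : circle o m * mono m n) :
  loop_at (sres f l) y = sres f (loop_at l y).
Proof.
by case: y => c s; congr (sres f (loop_at l (_, _))); exact: sig_ext.
Qed.

Lemma loop_at_sop (C : category) (X : sPsh C) (a : C) n k (t : mono k n)
  (l : inertia X a n) o m (y : circle o m * mono m k) :
  loop_at (sop t l) y = loop_at l (y.1, mono_comp t y.2).
Proof. exact: sres1. Qed.

Lemma loop_ext (C : category) (X : sPsh C) a n (l k : inertia X a n) :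
  (forall o m (y : circle o m * mono m n), loop_at l y = loop_at k y) -> l = k.
Proof. by move=> lk; apply: smap_ext => o m; exact: lk. Qed.

Lemma points_ext (C : category) (X : sPsh C) n (x y : points X tt n) :
  (forall a, sval x a = sval y a) -> x = y.
Proof. by move=> xy; apply: sig_ext; exact: functional_extensionality_dep. Qed.

(** An elementary homotopy [H] from [f] to [g] gives the edge whose value at a
    point [c] of the circle and [s] of the interval is [H (l c, s)]. *)
Lemma inertia_map_connected (C : category) (X Y : sPsh C) (f g : smap X Y)
  (l : points (inertia X) tt 0%N) : homotopic f g ->
  connected_to (points_map (inertia_map f) tt 0%N l)
               (points_map (inertia_map g) tt 0%N l).
Proof.
elim=> {f g} [f g [H [H0 H1]]|f|f g _|f g k _ fg _ gk].
- have e_nat a : @is_natural _ (sprod circle (scst point_cat (simplex 1)))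
      (seval Y a) (fun o m y => H a m ((sval l a : smap _ _) o m
        (y.1, mono_cst m ord0), y.2)).
    move=> o' o u m n t y; rewrite -[RHS]smap_sop.
    congr (H a m _); apply: congr2; last exact: sig_ext.
    rewrite -[RHS](@smap_nat point_cat _ _ (sval l a) o' o u).
    by congr (sval (sval l a) _ _ (_, _)); exact: mono0_eq.
  pose e a : inertia Y a 1%N := mksmap _ (e_nat a).
  have e_glob : is_global e.
    move=> b a u; apply: loop_ext => o m y.
    rewrite loop_at_sres -(smap_sres H) /loop_at /= -(proj2_sig l b a u).
    congr (H b m (_, _)); exact: sig_ext.
  apply: rst_step; exists (exist _ e e_glob).
  have s0 m (y : circle tt m * mono m 0) : (y.1, mono_cst m ord0) = y.
    by case: y => c s; congr (_, _); exact: mono0_eq.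
  split; apply: points_ext => a; apply: loop_ext => -[] m y;
    rewrite (@loop_at_sop _ _ _ _ _ _ (e a)) /loop_at /=.
    by rewrite -[RHS]H0 s0; congr (H a m (_, _)); exact: sig_ext.
  by rewrite -[RHS]H1 s0; congr (H a m (_, _)); exact: sig_ext.
- exact: rst_refl.
- exact: rst_sym.
- exact: rst_trans fg gk.
Qed.

(** The two ends of the interval are identified in the circle. *)
Lemma circle_vertex (c d : circle tt 0%N) : c = d.
Proof.
apply: sig_ext; rewrite (mono_cstE (sval c)) (mono_cstE (sval d)).
by rewrite (proj2_sig c) (proj2_sig d).
Qed.

(** Simplices of a discrete presheaf are determined by their first vertex, and
    all vertices of a loop are its base point. *)
Lemma discrete_loop (C : category) (F : set_presheaf C)
  (l : points (inertia (discrete F)) tt 0%N) :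
  exists f : points (discrete F) tt 0%N,
    l = points_map (identity_loop (discrete F)) tt 0%N f.
Proof.
have base0 : sval (mono_cst 0 i10) ord0 = i10 by [].
pose base : circle tt 0%N :=
  exist (fun s : mono 0 1 => sval s ord0 = i10) _ base0.
pose f a : discrete F a 0%N := (sval l a : smap _ _) tt 0%N (base, mono_id 0).
have lE a m (c : circle tt m) (s : mono m 0) :
    (sval l a : smap _ _) tt m (c, s) = f a :> F a.
  set cs : sprod circle (scst point_cat (simplex 0)) tt m := (c, s).
  have e : (sval l a : smap _ _) tt m cs =
      (sval l a : smap _ _) tt 0%N (vertex ord0 cs) :> F a.
    by rewrite smap_sop; exact: (esym (@sop_discrete _ F a _ _ _ _)).
  rewrite e (_ : vertex ord0 cs = (base, mono_id 0)) //.
  exact: (congr2 pair (circle_vertex _ _) (mono0_eq _ _)).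
have f_glob : is_global f.
  move=> b a u.
  rewrite -(@loop_at_sres _ (discrete F) _ _ u _ (sval l a)).
  by rewrite (proj2_sig l b a u).
exists (exist _ f f_glob); apply: points_ext => a.
apply: smap_ext => -[] m [c s].
rewrite lE; exact: (esym (sop_discrete s (f a))).
Qed.

(** With [h] an equivalence to a discrete presheaf and [k] an inverse, a loop
    [l] is connected to [k (h l)], the image of a constant loop. *)
Lemma zero_stack_trivial_inertia (C : category)
  (tau : forall a : C, sieve a -> Prop) (X : sPsh C) :
  is_zero_stack tau X -> only_trivial_inertia X.
Proof.
move=> [F _ [h [k [kh _]]]] _ [l _ <-].
have [f fE] := discrete_loop (points_map (inertia_map h) tt 0%N l).
exists (points_map k tt 0%N f).
change (connected_to l
  (points_map (identity_loop X) tt 0%N (points_map k tt 0%N f))).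
have -> : points_map (identity_loop X) tt 0%N (points_map k tt 0%N f) =
    points_map (inertia_map (scomp k h)) tt 0%N l.
  transitivity (points_map (inertia_map k) tt 0%N
                  (points_map (inertia_map h) tt 0%N l)).
    rewrite fE; apply: points_ext => a.
    by apply: smap_ext => o m y; exact: (esym (smap_sop k _ _)).
  apply: points_ext => a; exact: smap_ext.
apply: connected_sym; have := inertia_map_connected l kh.
rewrite (_ : points_map (inertia_map (sid X)) tt 0%N l = l) //.
apply: points_ext => a; exact: smap_ext.
Qed.

(** * Vanishing of the reduced contextuality degree *)

Lemma classical_realizationT (R : realType) (A : opsem_system R)
  (pi : color_context A) (X : spectral_stack pi) (x : points X tt 0%N) :
  classical_realization x.
Proof.
move=> C; exists (realization_sieve (spec_unit X) (sval x C)).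
  exact: hypersheafification_unit_surj (sys_tau_topology A) (spec_unitP X) _ _.
by move=> D f [r xr]; exists r; rewrite -(proj2_sig x D C f).
Qed.

Lemma trivial_inertia_ctx_deg (R : realType) (A : opsem_system R)
  (pi : color_context A) (X : spectral_stack pi) :
  only_trivial_inertia X -> ctx_deg_red X = 0.
Proof.
move=> Xtriv; suff e : pi0 (nontrivial_inertia X) = set0.
  by rewrite /ctx_deg_red e /counting asboolT // fset_set0.
apply/seteqP; split=> // s [[l Vl] _ _] /=.
have [x lx] := Xtriv _ (imageT (@component _) (vertex ord0 l)).
apply: (Vl ord0); exists x; first exact: classical_realizationT.
exact: connected_sym.
Qed.

Theorem proposition14 (R : realType) (A : opsem_system R)
  (pi : color_context A) (X : spectral_stack pi) :
  (local_realizations_glue X -> only_trivial_inertia X -> ctx_deg_red X = 0) /\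
  (is_commutative A -> is_zero_stack (@sys_tau R A) X -> ctx_deg_red X = 0).
Proof.
split=> _ h; apply: trivial_inertia_ctx_deg => //.
exact: zero_stack_trivial_inertia h.
Qed.
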